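(* Let $\Psi:[0,\ell(I)[\,\to\mathbb{R}_+$ and assume that the map $t\mapsto\Psi(t)/t$ is locally integrable on $[0,\ell(I)[$, and let $\Phi:[0,\ell(I)[\,\to\mathbb{R}_+$ satisfy $$\Phi(u)=\Psi(u)+\int_0^u\frac{\Psi(t)}{t}\,dt\qquad(u\in\,]0,\ell(I)[).$$ If $f:I\to\mathbb{R}$ is a lower semicontinuous solution of $$\frac{1}{v-u}\int_u^v f\le f(v)+\Psi(v-u)\qquad(u,v\in I,\ u<v),$$ then $f$ is $\Phi$-monotone on $I$.
   Context: $I$ is a nonempty open real interval and $\ell(I)\in\,]0,\infty]$ is its length; $\mathbb{R}_+=[0,\infty[$. A function on an interval is locally integrable if it has a finite Lebesgue integral over every compact subinterval of its domain (the value of $\Psi(t)/t$ at $t=0$ is irrelevant). The value $\Phi(0)\ge0$ is arbitrary. $f:I\to\mathbb{R}$ is $\Phi$-monotone if $f(x)\le f(y)+\Phi(y-x)$ for all $x,y\in I$ with $x\le y$. The integral of the lower semicontinuous function $f$ over $[u,v]$ is the Lebesgue integral, which exists in $]-\infty,\infty]$ since $f$ is bounded below on compact intervals. *)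

(* Defs.v *)
From HB Require Import structures.
From mathcomp Require Import all_boot all_order all_algebra.
From mathcomp Require Import all_classical all_reals all_analysis.
Import Order.TTheory GRing.Theory Num.Theory.
Import numFieldNormedType.Exports.

Set Implicit Arguments.
Unset Strict Implicit.
Unset Printing Implicit Defensive.

Local Open Scope classical_set_scope.
Local Open Scope ring_scope.

(* A real function on a set D is represented by a total function R -> R of
   which only the values on D matter. *)

(* Since [wlength] takes the extended endpoints of the interval hull,
   [wlength idfun I] is sup I - inf I in [\bar R] for a nonempty interval I. *)
Definition itv_length {R : realType} (I : set R) : \bar R := wlength idfun I.

Definition itv0_length {R : realType} (I : set R) : set R :=
  [set t | 0 <= t /\ (t%:E < itv_length I)%E].

(* The completed Lebesgue measure is used so that integrability means Lebesgue
   rather than Borel measurability of the integrand.  The library's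
   [locally_integrable] is not applicable, as it requires D to be open. *)
Definition locally_integrable_on {R : realType} (D : set R) (g : R -> R) :=
  forall a b : R, `[a, b] `<=` D ->
    (@completed_lebesgue_measure R).-integrable `[a, b] (EFin \o g).

Definition lower_semicontinuous_on {R : realType} (D : set R) (f : R -> R) :=
  lower_semicontinuous (EFin \o f : subspace D -> \bar R).

Definition Phi_monotone {R : realType} (I : set R) (Phi f : R -> R) :=
  forall x y : R, I x -> I y -> x <= y -> f x <= f y + Phi (y - x).

(* Main.v *)
(* Fix x < y, put d = y - x and g t = f (x + t) + c, where c makes g
   nonnegative on [0, d] (f is bounded below on compact intervals).  Let
   A s = s^-1 * \int_0^s g.  Almost everywhere A' s = (g s - A s) / s, which
   by hypothesis is at least - Psi s / s; hence
   A v <= A d + \int_v^d Psi t / t.  Lower semicontinuity gives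
   g 0 <= liminf_(v -> 0) A v, and A d <= g d + Psi d.  The differentiation of
   A is avoided: Tonelli's theorem on the triangle 0 <= t <= s with weight
   s^-2 gives directly the integrated identity
   \int_v^d A s / s + A d = A v + \int_v^d g t / t. *)

Require Import Defs.
From HB Require Import structures.
From mathcomp Require Import all_boot all_order all_algebra.
From mathcomp Require Import all_classical all_reals all_analysis.
From mathcomp Require Import measurable_realfun ring lra.
Import Order.TTheory GRing.Theory Num.Theory.
Import numFieldNormedType.Exports.

Local Open Scope classical_set_scope.
Local Open Scope ring_scope.

(** * Translation and the completed Lebesgue measure *)

Lemma measurable_shift_completed (R : realType) (x : R) :
  measurable_fun [set: caratheodory_type (wlength (@idfun R))^*%mu]
    ((fun t => t - x) : _ -> measurableTypeR R).
Proof.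
move=> _ Y mY; rewrite setTI; apply: sub_caratheodory.
have : measurable_fun [set: measurableTypeR R] (fun t : R => t - x).
  by apply: measurable_funD.
by move=> /(_ measurableT Y mY); rewrite setTI.
Qed.

(** The pushforward of the completed measure along [t - x] is a Borel measure that agrees with
    Lebesgue measure on the intervals []a, b]], hence everywhere by uniqueness. One change of
    variables thus handles both the translation and the passage between the two measures. *)
Lemma ge0_integral_completed_shift (R : realType) (x : R) (D : set R)
    (F : R -> \bar R) :
  measurable D -> measurable_fun D F -> (forall t, D t -> 0 <= F t)%E ->
  (\int[@lebesgue_measure R]_(t in D) F t =
   \int[@completed_lebesgue_measure R]_(t in (fun t => (t - x)%R) @^-1` D) F (t - x)%R)%E.
Proof.
move=> mD mF F0.
have m := (measurable_shift_completed R x).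
rewrite -[RHS](ge0_integral_pushforward m)//; last first.
  by move=> t; rewrite inE; exact: F0.
apply: eq_measure_integral => //= A mA _.
apply: lebesgue_measure_unique => // _ [[a b]] _ <-.
rewrite lebesgue_measure_itv/= lte_fin -EFinB.
(* As set functions the completed measure and [lebesgue_measure] are convertible, so the measure of
   the preimage can be computed with the latter. *)
transitivity (@lebesgue_measure R `](a + x), (b + x)]).
  rewrite lebesgue_measure_itv/= !lte_fin ltrD2r -!EFinB.
  by have -> : (b + x - (a + x) = b - a)%R by ring.
rewrite /pushforward; congr (lebesgue_measure _).
by apply/seteqP; split => t /=; rewrite !in_itv/= => /andP[? ?]; apply/andP; split; lra.
Qed.

(** * Tonelli's theorem on a triangle and the weight [s ^- 2] *)

Lemma continuous_invX (R : realType) (n : nat) (D : set R) :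
  (forall s, D s -> 0 < s) -> {within D, continuous (fun s : R => s ^- n)}.
Proof.
move=> D0; apply: continuous_in_subspaceT => s /[!inE] /D0 s0.
apply: (@continuousV _ _ (fun s : R => s ^+ n)); last exact: exprn_continuous.
by rewrite expf_neq0// gt_eqF.
Qed.

Lemma integral_invsqr (R : realType) (a d : R) : 0 < a -> a <= d ->
  (\int[@lebesgue_measure R]_(s in `[a, d]) (s ^- 2)%:E = (a^-1 - d^-1)%:E)%E.
Proof.
move=> a0; rewrite le_eqVlt => /predU1P[<-|ad].
  by rewrite set_itv1 integral_set1 subrr.
have dV (s : R) : 0 < s -> is_derive s 1 (fun s => - s^-1) (s ^- 2).
  move=> s0; have s1 : s != 0 by rewrite gt_eqF.
  have -> : s ^- 2 = - (- s ^- 2 *: 1) by rewrite /GRing.scale/= mulr1 opprK.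
  by apply: is_deriveN; exact: is_deriveV.
have cV (s : R) : 0 < s -> {for s, continuous (fun s : R => - s^-1)}.
  move=> s0; apply: continuousN; apply: inv_continuous.
  by rewrite gt_eqF.
have d0 := lt_trans a0 ad.
rewrite (@continuous_FTC2 _ (fun s => s ^- 2) (fun s => - s^-1))//.
- by rewrite -EFinB opprK addrC.
- by apply: continuous_invX => s /=; rewrite in_itv/= => /andP[+ _]; exact: lt_le_trans.
- split.
  + move=> s; rewrite in_itv/= => /andP[sa _].
    by have [] := dV s (lt_trans a0 sa).
  + by apply: cvg_at_right_filter; exact: cV.
  + by apply: cvg_at_left_filter; exact: cV.
- move=> s; rewrite in_itv/= => /andP[sa _].
  by rewrite derive1E; have [_ ->] := dV s (lt_trans a0 sa).
Qed.

Lemma measurable_triangle (R : realType) :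
  measurable ([set z | 0 <= z.2 <= z.1] : set (measurableTypeR R * measurableTypeR R)).
Proof.
rewrite (_ : [set z | _] = [set z | 0 <= z.2] `&` [set z | z.2 <= z.1]); last first.
  by apply/seteqP; split => [z /andP[]|z [/= -> ->]].
apply: measurableI.
  have := @measurable_snd _ _ (measurableTypeR R) (measurableTypeR R).
  move=> /(_ measurableT [set` `[0, +oo[] (measurable_itv _)); rewrite setTI.
  by congr measurable; apply/seteqP; split => z /=; rewrite in_itv/= andbT.
have := @measurable_fun_ler _ (measurableTypeR R * measurableTypeR R)%type R setT snd fst.
move=> /(_ measurable_snd measurable_fst measurableT [set true]).
by rewrite setTI; exact.
Qed.

(** The primitive is a section integral of [g t] times the indicator of the triangle [0 <= t <= s],
    so Tonelli's theorem yields measurability; for [s < 0] both the section and the interval are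
    empty. *)
Lemma measurable_primitive (R : realType) (g : R -> R) (D : set R) :
  measurable_fun [set: R] g -> (forall t, 0 <= g t) ->
  measurable_fun D (fun s => \int[@lebesgue_measure R]_(t in `[0%R, s]) (g t)%:E)%E.
Proof.
move=> mg g0; apply: measurable_funTS.
pose T : set (measurableTypeR R * measurableTypeR R) := [set z | 0 <= z.2 <= z.1].
pose h (z : measurableTypeR R * measurableTypeR R) := (g z.2 * \1_T z)%:E.
have mh : measurable_fun setT h.
  apply/measurable_EFinP; apply: measurable_funM.
    exact: measurableT_comp.
  by apply: measurable_indic; exact: measurable_triangle.
have h0 z : (0 <= h z)%E by rewrite lee_fin !mulr_ge0.
have := @measurable_fun_fubini_tonelli_F _ _ _ _ _ (@lebesgue_measure R) h mh h0.
congr measurable_fun; apply/funext => s; rewrite /fubini_F [RHS]integral_mkcond.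
apply: eq_integral => t _.
rewrite patchE /h indicE.
rewrite (_ : (s, t) \in T = (0 <= t <= s)); last by apply/idP/idP; rewrite inE.
rewrite mem_setE in_itv/=.
by case: ifP => _; rewrite ?mulr1 ?mulr0.
Qed.

(** Both sides are iterated integrals of [w s * g t] over the triangle [0 <= t <= s], in the two
    orders of integration. *)
Lemma integral_triangle (R : realType) (g w : R -> R) :
  measurable_fun [set: R] g -> measurable_fun [set: R] w ->
  (forall t, 0 <= g t) -> (forall t, 0 <= w t) ->
  (\int[@lebesgue_measure R]_s ((w s)%:E * \int[@lebesgue_measure R]_(t in `[0%R, s]) (g t)%:E) =
   \int[@lebesgue_measure R]_(t in `[0%R, +oo[) ((g t)%:E * \int[@lebesgue_measure R]_(s in `[t, +oo[) (w s)%:E))%E.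
Proof.
move=> mg mw g0 w0.
pose T : set (measurableTypeR R * measurableTypeR R) := [set z | 0 <= z.2 <= z.1].
pose h (z : measurableTypeR R * measurableTypeR R) := (w z.1 * g z.2 * \1_T z)%:E.
have mh : measurable_fun setT h.
  apply/measurable_EFinP; apply: measurable_funM; last first.
    by apply: measurable_indic; exact: measurable_triangle.
  by apply: measurable_funM; apply: measurableT_comp.
have h0 z : (0 <= h z)%E by rewrite lee_fin !mulr_ge0.
have mgE (D : set R) : measurable_fun D (fun t => (g t)%:E).
  by apply/measurable_EFinP; exact: measurable_funTS.
have mwE (D : set R) : measurable_fun D (fun t => (w t)%:E).
  by apply/measurable_EFinP; exact: measurable_funTS.
have TE s t : (\1_T (s, t) : R) = ((0 <= t) && (t <= s))%:R.
  by rewrite indicE; congr (nat_of_bool _)%:R; apply/idP/idP; rewrite inE.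
transitivity (\int[@lebesgue_measure R]_s \int[@lebesgue_measure R]_t h (s, t))%E.
  apply: eq_integral => s _.
  rewrite -ge0_integralZl ?lee_fin//; [|exact: mgE|by move=> t _; rewrite lee_fin].
  rewrite integral_mkcond; apply: eq_integral => t _.
  rewrite patchE /h /= TE mem_setE in_itv/=.
  by case: ifP => _; rewrite ?mulr1 ?mulr0.
rewrite (@fubini_tonelli _ _ _ _ _ lebesgue_measure lebesgue_measure _ mh h0).
rewrite [RHS]integral_mkcond.
apply: eq_integral => t _; rewrite patchE mem_setE /= in_itv/= andbT.
case: ifPn => t0.
  rewrite -ge0_integralZl ?lee_fin//; [|exact: mwE|by move=> s _; rewrite lee_fin].
  rewrite [RHS]integral_mkcond; apply: eq_integral => s _.
  rewrite patchE /h /= TE t0 mem_setE in_itv/= andbT.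
  by case: ifP => _; rewrite ?mulr1 ?mulr0// mulrC.
rewrite integral0_eq// => s _.
by rewrite /h TE (negbTE t0) mulr0.
Qed.

Lemma measurable_invX (R : realType) (n : nat) (a d : R) : 0 < a ->
  measurable_fun `[a, d] (fun s : R => s ^- n).
Proof.
move=> a0; apply: subspace_continuous_measurable_fun => //.
by apply: continuous_invX => s /=; rewrite in_itv/= => /andP[+ _]; exact: lt_le_trans.
Qed.

(** After exchanging the integrals, [g t] carries the weight obtained by integrating [s ^- 2] from
    [max v t] to [d], that is [q t - d^-1] with [q t] the inverse of [max v t]. The second summand
    on the left cancels [- d^-1]; what remains, the integral of [q t * g t] over [[0, d]], is split
    at [v]. *)
Lemma integral_average (R : realType) (g : R -> R) (v d : R) :
  measurable_fun [set: R] g -> (forall t, 0 <= g t) -> 0 < v -> v <= d ->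
  (\int[@lebesgue_measure R]_(s in `[v, d])
      ((s ^- 2)%:E * \int[@lebesgue_measure R]_(t in `[0%R, s]) (g t)%:E) +
    (d^-1)%:E * \int[@lebesgue_measure R]_(t in `[0%R, d]) (g t)%:E =
   (v^-1)%:E * \int[@lebesgue_measure R]_(t in `[0%R, v]) (g t)%:E +
    \int[@lebesgue_measure R]_(t in `[v, d]) (g t / t)%:E)%E.
Proof.
move=> mg g0 v0 vd.
have d0 := lt_le_trans v0 vd.
pose w := (fun s : R => s ^- 2) \_ `[v, d].
have mw : measurable_fun [set: R] w.
  by apply/(measurable_restrictT _ _).1 => //; exact: measurable_invX.
have w0 t : 0 <= w t.
  by rewrite /w patchE; case: ifP => // _; rewrite invr_ge0 sqr_ge0.
pose q (t : R) := (Num.max v t)^-1.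
have q0 t : 0 <= q t by rewrite invr_ge0 le_max ltW.
have mq : measurable_fun [set: R] q.
  apply: continuous_measurable_fun => t.
  apply: (@continuousV _ _ (fun t => Num.max v t)).
    by rewrite gt_eqF// lt_max v0.
  exact: (@continuous_max _ _ (fun=> v) id t (@cst_continuous _ _ _ _) _).
pose k (t : R) := q t - d^-1.
have k0 t : t <= d -> 0 <= k t.
  by move=> td; rewrite subr_ge0 lef_pV2 ?posrE ?lt_max ?v0// ge_max vd.
(* The support of [w] cuts [[t, +oo[] down to [[max v t, d]], which is empty for [t > d]. *)
have intw t : (\int[@lebesgue_measure R]_(s in `[t, +oo[) (w s)%:E =
    if (t <= d)%R then (k t)%:E else 0)%E.
  rewrite /w -[LHS]/(integral lebesgue_measure `[t, +oo[ (EFin \o w)) -restrict_EFin -integral_mkcondr.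
  case: ifPn => td.
    rewrite -integral_invsqr ?lt_max ?v0// ?ge_max ?vd//.
    congr (integral _ _ _); apply/seteqP; split => s /=; rewrite !in_itv/= ge_max andbT.
      by move=> [-> /andP[-> ->]].
    by move=> /andP[/andP[-> ->] ->].
  rewrite [X in integral _ X](_ : _ = set0) ?integral_set0//.
  apply/seteqP; split => s //=; rewrite !in_itv/= andbT => -[ts /andP[_ sd]].
  by move: td; rewrite (le_trans ts sd).
have mgE (D : set R) : measurable_fun D (fun t => (g t)%:E).
  by apply/measurable_EFinP; exact: measurable_funTS.
have mqE (D : set R) : measurable_fun D (fun t => (q t * g t)%:E).
  by apply/measurable_EFinP; apply: measurable_funM; exact: measurable_funTS.
have := @integral_triangle R g w mg mw g0 w0.
have -> : (\int[@lebesgue_measure R]_s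
      ((w s)%:E * \int[@lebesgue_measure R]_(t in `[0%R, s]) (g t)%:E) =
    \int[@lebesgue_measure R]_(s in `[v, d])
      ((s ^- 2)%:E * \int[@lebesgue_measure R]_(t in `[0%R, s]) (g t)%:E))%E.
  rewrite [RHS]integral_mkcond; apply: eq_integral => s _.
  by rewrite /w !patchE; case: ifP => _ //; rewrite mul0e.
move=> ->.
have -> : (\int[@lebesgue_measure R]_(t in `[0%R, +oo[)
      ((g t)%:E * \int[@lebesgue_measure R]_(s in `[t, +oo[) (w s)%:E) =
    \int[@lebesgue_measure R]_(t in `[0%R, d]) (g t * k t)%:E)%E.
  rewrite integral_mkcond [RHS]integral_mkcond; apply: eq_integral => t _.
  rewrite !patchE !mem_setE intw !in_itv/= andbT.
  by case: (0 <= t) => //=; case: ifP => //; rewrite mule0.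
rewrite -ge0_integralZl ?lee_fin ?invr_ge0//; last 3 first.
- exact: mgE.
- by move=> t _; rewrite lee_fin.
- exact: ltW.
rewrite -ge0_integralD//; last 4 first.
- by move=> t /=; rewrite in_itv/= => /andP[_ /k0 ?]; rewrite lee_fin mulr_ge0.
- apply/measurable_EFinP; apply: measurable_funM; first exact: measurable_funTS.
  by apply: measurable_funD => //; exact: measurable_funTS.
- by move=> t _; rewrite lee_fin mulr_ge0 ?invr_ge0// ltW.
- by apply: measurable_funeM; exact: mgE.
transitivity (\int[@lebesgue_measure R]_(t in `[0%R, d]) (q t * g t)%:E)%E.
  by apply: eq_integral => t _; rewrite -EFinM -EFinD; congr EFin; rewrite /k; ring.
rewrite (_ : [set` `[0, d]] = `[0, v[ `|` `[v, d]); last first.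
  apply/seteqP; split => t /=; rewrite !in_itv/=.
    by move=> /andP[-> ->]; case: (ltP t v); [left|right].
  case=> /andP[]; first by move=> -> /ltW /le_trans ->.
  by move=> vt ->; rewrite (le_trans (ltW v0) vt).
rewrite ge0_integral_setU//; last 3 first.
- exact: mqE.
- by move=> t _; rewrite lee_fin mulr_ge0.
- apply/disj_set2P; apply/seteqP; split => t //=; rewrite !in_itv/=.
  by move=> [/andP[_ tv] /andP[/(lt_le_trans tv)]]; rewrite ltxx.
congr (_ + _)%E.
  rewrite -ge0_integralZl ?lee_fin ?invr_ge0//; last 3 first.
  - exact: mgE.
  - by move=> t _; rewrite lee_fin.
  - exact: ltW.
  rewrite integral_itv_bndo_bndc//.
  apply: eq_integral => t; rewrite inE/= in_itv/= => /andP[_ tv].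
  by rewrite /q max_l// EFinM.
apply: eq_integral => t; rewrite inE/= in_itv/= => /andP[tv _].
by rewrite /q max_r// mulrC.
Qed.

(** * Integrating the averaging inequality *)

Lemma measurable_fun_completed (R : realType) d (T : measurableType d)
    (D : set R) (F : R -> T) :
  measurable D -> measurable_fun D F ->
  measurable_fun (D : set (caratheodory_type (wlength (@idfun R))^*%mu)) F.
Proof.
by move=> mD mF _ Y mY; apply: sub_caratheodory; exact: mF.
Qed.

Lemma ge0_integral_completed (R : realType) (D : set R) (F : R -> \bar R) :
  measurable D -> measurable_fun D F -> (forall t, D t -> 0 <= F t)%E ->
  (\int[@lebesgue_measure R]_(t in D) F t =
   \int[@completed_lebesgue_measure R]_(t in D) F t)%E.
Proof.
move=> mD mF F0; rewrite (@ge0_integral_completed_shift _ 0)//.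
rewrite [X in integral _ X](_ : _ = D); last by apply/funext => t; rewrite /preimage/= subr0.
by apply: eq_integral => t _; rewrite subr0.
Qed.

Lemma ge0_le_integralD d (T : measurableType d) (R : realType)
    (mu : {measure set T -> \bar R}) (D : set T) (F1 F2 F3 : T -> \bar R) :
  measurable D ->
  measurable_fun D F1 -> measurable_fun D F2 -> measurable_fun D F3 ->
  (forall t, D t -> 0 <= F1 t)%E -> (forall t, D t -> 0 <= F2 t)%E ->
  (forall t, D t -> 0 <= F3 t)%E -> (forall t, D t -> F1 t <= F2 t + F3 t)%E ->
  (\int[mu]_(t in D) F1 t <= \int[mu]_(t in D) F2 t + \int[mu]_(t in D) F3 t)%E.
Proof.
move=> mD mF1 mF2 mF3 F10 F20 F30 le; rewrite -ge0_integralD//.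
by apply: ge0_le_integral => //; exact: emeasurable_funD.
Qed.

(** Divided by [s] and integrated over [[v, d]], the hypothesis on averages bounds the first
    integral of [integral_average]. The integral of [g t / t] then occurs on both sides and cancels,
    once it is known to be finite. *)
Lemma average_le (R : realType) (g Psi : R -> R) (v d : R) :
  measurable_fun [set: R] g -> (forall t, 0 <= g t) ->
  (forall t, 0 <= t -> t <= d -> 0 <= Psi t) ->
  (@completed_lebesgue_measure R).-integrable `[0, d] (EFin \o (fun t => Psi t / t)) ->
  (forall s, (0 < s)%R -> (s <= d)%R ->
    (s^-1)%:E * \int[@lebesgue_measure R]_(t in `[0%R, s]) (g t)%:E
      <= (g s + Psi s)%:E)%E ->
  0 < v -> v <= d ->
  ((v^-1)%:E * \int[@lebesgue_measure R]_(t in `[0%R, v]) (g t)%:E <=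
   (d^-1)%:E * \int[@lebesgue_measure R]_(t in `[0%R, d]) (g t)%:E +
   \int[@completed_lebesgue_measure R]_(t in `[0%R, d]) (Psi t / t)%:E)%E.
Proof.
move=> mg g0 Psi0 iPsi avg v0 vd.
have d0 := lt_le_trans v0 vd.
have mgE (D : set R) : measurable_fun D (fun t => (g t)%:E).
  by apply/measurable_EFinP; exact: measurable_funTS.
have G0 s : (0 <= \int[@lebesgue_measure R]_(t in `[0%R, s]) (g t)%:E)%E.
  by apply: integral_ge0 => t _; rewrite lee_fin.
have mgt : measurable_fun `[v, d] (fun t => (g t / t)%:E).
  apply/measurable_EFinP; apply: measurable_funM; first exact: measurable_funTS.
  exact: (@measurable_invX _ 1).
have mG : measurable_fun `[v, d] (fun s => (s ^- 2)%:E *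
    \int[@lebesgue_measure R]_(t in `[0%R, s]) (g t)%:E)%E.
  apply: emeasurable_funM; last exact: measurable_primitive.
  by apply/measurable_EFinP; exact: measurable_invX.
have itv0 t : `[v, d]%classic t -> 0 < t.
  by rewrite /= in_itv/= => /andP[+ _]; exact: lt_le_trans.
have gt0 t : `[v, d]%classic t -> (0 <= (g t / t)%:E)%E.
  by move=> /itv0 t0; rewrite lee_fin divr_ge0// ltW.
have Pt0 t : `[0, d]%classic t -> (0 <= (Psi t / t)%:E)%E.
  by rewrite /= in_itv/= => /andP[? ?]; rewrite lee_fin divr_ge0// Psi0.
have sub : `[v, d] `<=` `[0, d].
  by move=> t /=; rewrite !in_itv/= => /andP[vt ->]; rewrite (le_trans (ltW v0) vt).
have mcP : measurable (`[0, d] : set (caratheodory_type (wlength (@idfun R))^*%mu)).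
  by apply: sub_caratheodory; exact: measurable_itv.
have mcv : measurable (`[v, d] : set (caratheodory_type (wlength (@idfun R))^*%mu)).
  by apply: sub_caratheodory; exact: measurable_itv.
have mP := measurable_int _ iPsi.
have mPv := measurable_funS mcP sub mP.
have step : (\int[@lebesgue_measure R]_(s in `[v, d])
      ((s ^- 2)%:E * \int[@lebesgue_measure R]_(t in `[0%R, s]) (g t)%:E) <=
    \int[@lebesgue_measure R]_(t in `[v, d]) (g t / t)%:E +
    \int[@completed_lebesgue_measure R]_(t in `[0%R, d]) (Psi t / t)%:E)%E.
  apply: (@le_trans _ _ (\int[@lebesgue_measure R]_(t in `[v, d]) (g t / t)%:E +
    \int[@completed_lebesgue_measure R]_(t in `[v, d]) (Psi t / t)%:E)%E); last first.
    by apply: leeD => //; exact: ge0_subset_integral.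
  have G20 t : `[v, d]%classic t -> (0 <= (t ^- 2)%:E *
      \int[@lebesgue_measure R]_(t in `[0%R, t]) (g t)%:E)%E.
    by move=> /itv0 t0; rewrite mule_ge0// lee_fin invr_ge0 exprn_ge0// ltW.
  (* [Psi t / t] is only known to be measurable for the completed measure, so the integrals
     involving [g] are moved to that measure before the comparison. *)
  rewrite (ge0_integral_completed _ _ _ (measurable_itv _) mG G20).
  rewrite (ge0_integral_completed _ _ _ (measurable_itv _) mgt gt0).
  apply: ge0_le_integralD.
  - exact: mcv.
  - exact: (measurable_fun_completed _ _ _ _ _ (measurable_itv _) mG).
  - exact: (measurable_fun_completed _ _ _ _ _ (measurable_itv _) mgt).
  - exact: mPv.
  - exact: G20.
  - exact: gt0.
  - by move=> t tvd; apply: Pt0; exact: sub.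
  move=> t vtd; have t0 := itv0 _ vtd.
  rewrite -EFinD -mulrDl mulrC EFinM (_ : t ^- 2 = t^-1 * t^-1) ?EFinM -?muleA; last by rewrite -invfM.
  apply: lee_wpmul2l; first by rewrite lee_fin invr_ge0 ltW.
  by apply: avg => //; move: vtd; rewrite /= in_itv/= => /andP[].
set I := (\int[@lebesgue_measure R]_(t in `[0%R, d]) (g t)%:E)%E.
(* The hypothesis at [s = d] bounds [d^-1 * I] by a real number. *)
have Ifin : (I < +oo)%E.
  have := avg d d0 (lexx d); rewrite -/I => Id.
  have -> : I = (d%:E * ((d^-1)%:E * I))%E by rewrite muleA -EFinM divff ?mul1e// gt_eqF.
  by rewrite lte_mul_pinfty ?lee_fin ?(ltW d0)// (le_lt_trans Id) ?ltry.
have := @integral_average R g v d mg g0 v0 vd.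
set X := (\int[@lebesgue_measure R]_(t in `[v, d]) (g t / t)%:E)%E in step *.
(* On [[v, d]] one has [1 / t <= 1 / v], whence [X <= v^-1 * I]. *)
have Xfin : X \is a fin_num.
  rewrite ge0_fin_numE; last exact: integral_ge0.
  apply: (@le_lt_trans _ _ ((v^-1)%:E * I)%E); last first.
    by rewrite lte_mul_pinfty ?lee_fin ?invr_ge0 ?(ltW v0).
  rewrite -ge0_integralZl ?lee_fin ?invr_ge0 ?(ltW v0)//; last 2 first.
    exact: mgE.
    by move=> t _; rewrite lee_fin.
  apply: (@le_trans _ _ (\int[@lebesgue_measure R]_(t in `[v, d]) ((v^-1)%:E * (g t)%:E))%E).
    apply: ge0_le_integral => //.
      by apply: measurable_funeM; exact: mgE.
    move=> t; rewrite /= in_itv/= => /andP[vt _].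
    by rewrite -EFinM lee_fin mulrC ler_wpM2r// lef_pV2// posrE// (lt_le_trans v0).
  apply: ge0_subset_integral => //.
    by apply: measurable_funeM; exact: mgE.
  by move=> t _; rewrite -EFinM lee_fin mulr_ge0// invr_ge0 ltW.
(* Adding the finite [X] turns the left side of the goal into the right side of [E]; after rewriting
   with [E], the inequality [step] concludes. *)
rewrite -/I => E; rewrite -(leeD2rE _ _ Xfin) -E addeC -addeA.
by apply: leeD2l; rewrite [leRHS]addeC.
Qed.

(** The integral of [f] may be [+oo], so additivity is applied to nonnegative functions only:
    pointwise, [f + c] plus the negative part of [f] equals the positive part plus [c]. The negative
    part is at most [c], so its integral is finite and can be subtracted. *)
Lemma integralD_cst d (T : measurableType d) (R : realType)
    (mu : {measure set T -> \bar R}) (D : set T) (f : T -> R) (c : R) :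
  measurable D -> (mu D < +oo)%E -> measurable_fun D f ->
  0 <= c -> (forall t, D t -> - c <= f t) ->
  (\int[mu]_(t in D) (f t + c)%:E = \int[mu]_(t in D) (f t)%:E + c%:E * mu D)%E.
Proof.
move=> mD Doo mf c0 fc.
have mfE : measurable_fun D (EFin \o f) by exact/measurable_EFinP.
have fneg t : D t -> ((EFin \o f)^\- t <= c%:E)%E.
  move=> /fc; rewrite funenegE /= => ?.
  by rewrite ge_max !lee_fin c0 andbT lerNl.
have negoo : (\int[mu]_(t in D) ((EFin \o f)^\- t) < +oo)%E.
  apply: (@le_lt_trans _ _ (\int[mu]_(t in D) (cst c%:E t))%E).
    by apply: ge0_le_integral => //; exact: measurable_funeneg.
  by rewrite integral_cst// lte_mul_pinfty.
have negfin : (\int[mu]_(t in D) ((EFin \o f)^\- t))%E \is a fin_num.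
  by rewrite ge0_fin_numE// integral_ge0.
rewrite [in RHS]integralE addeAC; apply/eqP.
rewrite -(addeK (\int[mu]_(t in D) (f t + c)%:E) negfin); apply/eqP; congr (_ - _)%E.
rewrite -integral_cst// -!ge0_integralD//.
- apply: eq_integral => t _.
  rewrite EFinD addeAC; congr (_ + _)%E; rewrite funenegE funeposE /= -!EFin_max -EFinD.
  by congr EFin; rewrite addr_maxr subrr addr0 maxC.
- exact: measurable_funepos.
- by move=> t Dt; rewrite lee_fin -lerBlDr sub0r fc.
- by apply/measurable_EFinP; exact: measurable_funD.
- exact: measurable_funeneg.
Qed.

(** * Lower semicontinuous functions on open sets, and lengths inside an open interval *)

Lemma lower_semicontinuous_on_open (R : realType) (D : set R) (f : R -> R) (a : R) :
  open D -> lower_semicontinuous_on D f -> open (D `&` [set t | a < f t]).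
Proof.
move=> oD /lower_semicontinuousP/(_ a).
by rewrite -(open_setSI _ oD).
Qed.

Lemma lower_semicontinuous_on_measurable (R : realType) (D : set R) (f : R -> R) :
  open D -> lower_semicontinuous_on D f -> measurable_fun D f.
Proof.
move=> oD lf; apply: (measurability _ (RGenOInfty.measurableE R)).
move=> /= _ [_ [a ->]] <-; apply: open_measurable.
have := lower_semicontinuous_on_open _ _ _ a oD lf.
by congr open; apply/seteqP; split => t /=; rewrite in_itv/= andbT.
Qed.

(** Near each point of [K] some bound [- n] holds, together with all weaker ones; compactness, in
    the form of near coverings, makes a single [n] serve on all of [K]. *)
Lemma lower_semicontinuous_on_bounded_below (R : realType) (D K : set R) (f : R -> R) :
  open D -> lower_semicontinuous_on D f -> compact K -> K `<=` D ->
  exists2 c, 0 <= c & forall t, K t -> - c <= f t.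
Proof.
move=> oD lf /compact_near_coveringP cK KD.
have [|n _ /(_ n (leqnn n)) H] := cK nat \oo (fun n t => - n%:R <= f t) _.
  move=> x Kx.
  have [n xn] : exists n : nat, - n%:R < f x.
    exists (Num.truncn `|f x|).+1; rewrite ltrNl.
    by apply: le_lt_trans (truncnS_gt _); rewrite -normrN ler_norm.
  have : nbhs x (D `&` [set t | - n%:R < f t]).
    apply: open_nbhs_nbhs; split; first exact: lower_semicontinuous_on_open.
    by split => //; exact: KD.
  move=> nx; exists (D `&` [set t | - n%:R < f t], [set m | (n <= m)%N]).
    by split => //; exact: nbhs_infty_ge.
  move=> [t m] /= [[_ /ltW nt] nm]; apply: le_trans nt.
  by rewrite lerN2 ler_nat.
by exists n%:R => // t; exact: H.
Qed.

(** Strictness comes from openness: [I] contains a point [y + e / 2] beyond [y], hence the longer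
    segment from [x] to it. *)
Lemma itv0_lengthB (R : realType) (I : set R) (x y : R) :
  is_interval I -> open I -> I x -> I y -> x <= y -> itv0_length I (y - x).
Proof.
move=> I_itv oI Ix Iy xy; split; first by rewrite subr_ge0.
have [e /= e0 ye] : nbhs_ball y I by apply/nbhs_ballP; exact: open_nbhs_nbhs.
have Iz : I (y + e / 2).
  apply: ye; rewrite /ball/= opprD addNKr normrN gtr0_norm ?divr_gt0//.
  by rewrite ltr_pdivrMr// ltr_pMr// ltr1n.
have yz : y < y + e / 2 by rewrite ltrDl divr_gt0.
apply: (@lt_le_trans _ _ (wlength idfun `[x, y + e / 2])).
  rewrite wlength_itv_bnd/=; last by rewrite (le_trans xy) ?ltW.
  by rewrite lte_fin ltrD2r.
apply: le_wlength => [a b //|t /=]; rewrite in_itv/= => /andP[xt ty].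
by apply: (I_itv x (y + e / 2)) => //; rewrite xt ty.
Qed.

(** * Reduction to a nonnegative function on [[0, d]] and comparison of averages near 0 *)

Theorem theorem5p6 (R : realType) (I : set R)
    (I_itv : is_interval I) (I_open : open I) (I_neq0 : I !=set0)
    (Psi Phi f : R -> R)
    (Psi_ge0 : forall t, itv0_length I t -> 0 <= Psi t)
    (Psi_locint : locally_integrable_on (itv0_length I) (fun t => Psi t / t))
    (Phi_ge0 : forall t, itv0_length I t -> 0 <= Phi t)
    (PhiE : forall u, itv0_length I u -> 0 < u ->
      ((Phi u)%:E = (Psi u)%:E +
        \int[@completed_lebesgue_measure R]_(t in `[0%R, u])
          (Psi t / t)%:E)%E)
    (f_lsc : lower_semicontinuous_on I f)
    (f_sol : forall u v, I u -> I v -> u < v ->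
      (((v - u)^-1)%:E *
        \int[@completed_lebesgue_measure R]_(t in `[u, v]) (f t)%:E
       <= (f v + Psi (v - u))%:E)%E) :
  Phi_monotone I Phi f.
Proof.
move=> x y Ix Iy xy; have Id := itv0_lengthB _ _ _ _ I_itv I_open Ix Iy xy.
(* The formula for [Phi] is given only at positive arguments; for [x = y] the sign of [Phi 0]
   suffices. *)
move: xy; rewrite le_eqVlt => /predU1P[xy|xy].
  by rewrite -xy in Id *; rewrite lerDl Phi_ge0.
set d := y - x in Id *.
have d0 : 0 < d by rewrite subr_gt0.
have IdS t : 0 <= t -> t <= d -> itv0_length I t.
  by move=> t0 td; split => //; apply: le_lt_trans Id.2; rewrite lee_fin.
have xdE : x + d = y by rewrite /d addrC subrK.
have xyI : `[x, y] `<=` I.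
  move=> t /=; rewrite in_itv/= => /andP[xt ty].
  by apply: (I_itv x y) => //; rewrite xt ty.
have [c c0 fc] := lower_semicontinuous_on_bounded_below _ _ _ _ I_open f_lsc
  (@segment_compact _ x y) xyI.
have mfI := lower_semicontinuous_on_measurable _ _ _ I_open f_lsc.
have mf : measurable_fun `[x, y] f.
  by apply: measurable_funS mfI => //; exact: open_measurable.
(* Extension by 0 outside [[0, d]] makes [g] measurable and nonnegative on the whole line, as the
   Tonelli lemmas require. *)
pose g := (fun t => f (x + t) + c) \_ `[0, d].
have gE t : 0 <= t -> t <= d -> g t = f (x + t) + c.
  by move=> t0 td; rewrite /g patchE mem_setE in_itv/= t0 td.
have mg : measurable_fun [set: R] g.
  apply/(measurable_restrictT _ _).1 => //; apply: measurable_funD => //.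
  apply: (measurable_comp (measurable_itv `[x, y])) mf _.
    move=> _ [t /= + <-]; rewrite !in_itv/= => /andP[t0 td].
    by rewrite lerDl t0 -xdE lerD2l.
  by apply: measurable_funD.
have g0 t : 0 <= g t.
  rewrite /g patchE; case: ifPn => //; rewrite mem_setE in_itv/= => /andP[t0 td].
  by rewrite -lerBlDr sub0r fc//= in_itv/= lerDl t0 -xdE lerD2l.
have intg s : 0 < s -> s <= d ->
    (\int[@lebesgue_measure R]_(t in `[0%R, s]) (g t)%:E =
     \int[@completed_lebesgue_measure R]_(t in `[x, (x + s)%R]) (f t)%:E +
       c%:E * s%:E)%E.
  move=> s0 sd.
  have mgE : measurable_fun `[0, s] (EFin \o g).
    by apply/measurable_EFinP; exact: measurable_funTS.
  have gE0 t : `[0, s]%classic t -> (0 <= (EFin \o g) t)%E by rewrite lee_fin.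
  rewrite (ge0_integral_completed_shift _ x _ _ (measurable_itv _) mgE gE0).
  have -> : (fun t => t - x) @^-1` `[0, s] = [set` `[x, x + s]].
    by apply/seteqP; split => t /=; rewrite !in_itv/= subr_ge0 lerBlDl.
  have sub : `[x, x + s] `<=` `[x, y].
    move=> t /=; rewrite !in_itv/= => /andP[-> tx]; apply: le_trans tx _.
    by rewrite -xdE lerD2l.
  have mus : @completed_lebesgue_measure R `[x, x + s] = s%:E.
    transitivity (@lebesgue_measure R `[x, x + s]) => //.
    by rewrite lebesgue_measure_itv/= lte_fin ltrDl s0 -EFinB addrC addKr.
  have mcs : measurable (`[x, x + s] : set (caratheodory_type (wlength (@idfun R))^*%mu)).
    by apply: sub_caratheodory; exact: measurable_itv.
  rewrite -mus -integralD_cst.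
  - apply: eq_integral => t; rewrite inE/= in_itv/= => /andP[xt tx].
    by rewrite gE ?subr_ge0 ?lerBlDl ?(le_trans tx) ?lerD2l// (addrC x) subrK.
  - exact: mcs.
  - by rewrite [X in (X < _)%E]mus ltry.
  - apply: measurable_fun_completed; first exact: measurable_itv.
    exact: measurable_funS sub mf.
  - exact: c0.
  - by move=> t /sub; exact: fc.
(* This is [f_sol] on [[x, x + s]]: adding [c] to [f] adds [c] to the average and to the value at
   the right endpoint. *)
have avg s : 0 < s -> s <= d ->
    ((s^-1)%:E * \int[@lebesgue_measure R]_(t in `[0%R, s]) (g t)%:E
      <= (g s + Psi s)%:E)%E.
  move=> s0 sd; rewrite intg// muleDr//; last by rewrite fin_num_adde_defl.
  have Ixs : I (x + s) by apply: xyI; rewrite /= in_itv/= lerDl ltW// -xdE lerD2l.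
  have := f_sol x (x + s) Ix Ixs; rewrite ltrDl => /(_ s0).
  rewrite addrC addKr gE ?(ltW s0)// => fs.
  rewrite -!EFinM mulrCA mulVf ?gt_eqF// mulr1 addrAC EFinD leeD2r//.
have iPsi : (@completed_lebesgue_measure R).-integrable `[0, d]
    (EFin \o (fun t => Psi t / t)).
  by apply: Psi_locint => t /=; rewrite in_itv/= => /andP[]; exact: IdS.
(* The average over [[0, d]] is at most [g d + Psi d], and [Psi d] plus the remaining integral is
   [Phi d]. *)
have ave v : 0 < v -> v <= d ->
    ((v^-1)%:E * \int[@lebesgue_measure R]_(t in `[0%R, v]) (g t)%:E
      <= (f y + c + Phi d)%:E)%E.
  move=> v0 vd; rewrite EFinD PhiE// addeA -EFinD.
  apply: le_trans (average_le R g Psi v d mg g0 _ iPsi avg v0 vd) _.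
    by move=> t t0 td; apply: Psi_ge0; exact: IdS.
  by apply: leeD => //; have := avg d d0 (lexx d); rewrite gE ?(ltW d0)// xdE.
rewrite leNgt; apply/negP => lt.
(* The midpoint [a] lies strictly between the two sides. By lower semicontinuity [f > a] near [x],
   so a short average of [g] is at least [a + c], which contradicts [ave]. *)
pose a := (f y + Phi d + f x) / 2.
have ax : a < f x by rewrite /a; lra.
have ay : f y + Phi d < a by rewrite /a; lra.
have : nbhs x (I `&` [set t | a < f t]).
  apply: open_nbhs_nbhs; split; first exact: lower_semicontinuous_on_open.
  by [].
move=> /nbhs_ballP[e /= e0 xe].
(* [e / 2] keeps [x + t] inside the open ball for all [t <= v], and [d] keeps [t] where [g] agrees
   with the shifted [f]. *)
pose v := Num.min d (e / 2).
have v0 : 0 < v by rewrite lt_min d0 divr_gt0.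
have vd : v <= d by rewrite ge_min lexx.
have ve : v < e.
  by rewrite gt_min; apply/orP; right; rewrite ltr_pdivrMr// ltr_pMr// ltr1n.
have acv t : 0 <= t -> t <= v -> a + c <= g t.
  move=> t0 tv; rewrite gE ?(le_trans tv)// lerD2r ltW//.
  suff /xe[] : ball x e (x + t) by [].
  by rewrite /ball/= opprD addNKr normrN ger0_norm// (le_lt_trans tv).
(* Monotonicity of the integral is used for nonnegative functions, here for the constant [a + c]. *)
have ac0 : 0 <= a + c.
  have : - c <= f y by apply: fc; rewrite /= in_itv/= lexx ltW.
  by have := Phi_ge0 d Id; lra.
have := ave v v0 vd; rewrite leNgt => /negP; apply.
apply: (@lt_le_trans _ _ (a + c)%:E); first by rewrite lte_fin; lra.
have <- : ((v^-1)%:E * \int[@lebesgue_measure R]_(t in `[0%R, v]) (a + c)%:E = (a + c)%:E)%E.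
  rewrite integral_cst//= lebesgue_measure_itv/= lte_fin v0 -EFinB subr0 -!EFinM.
  by rewrite mulrCA mulVf ?gt_eqF// mulr1.
apply: lee_wpmul2l; first by rewrite lee_fin invr_ge0 ltW.
apply: ge0_le_integral => //.
- by apply/measurable_EFinP; exact: measurable_funTS.
- by move=> t /=; rewrite in_itv/= lee_fin => /andP[]; exact: acv.
Qed.
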